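(* Let $(y_n)_{n\geq -1}$ be a real sequence with $$y_{n+1}=\frac{3}{2}|y_n|+\frac{1}{2}y_n-y_{n-1}\qquad\text{for all } n\geq 0 .$$ If $(y_n)$ is not an equilibrium (that is, it is not a constant sequence), then $\lim_{n\to+\infty}y_n=+\infty$.
   Context: An equilibrium point of a difference equation is a value $\bar{x}$ such that the constant sequence $y_n=\bar{x}$ is a solution; a solution is determined by its real initial conditions $(y_{-1},y_0)$. *)

(* Defs.v *)
(* Stdlib reals, with Coquelicot for limits. *)
From Stdlib Require Import Reals ZArith.
From Coquelicot Require Import Coquelicot.

(* A sequence indexed by the integers n >= -1 is a function on Z of which only
   the values at n >= -1 are ever used. *)

Definition is_solution (y : Z -> R) : Prop :=
  forall n : Z, (0 <= n)%Z ->
    y (n + 1)%Z = (3 / 2 * Rabs (y n) + 1 / 2 * y n - y (n - 1)%Z)%R.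

Definition is_constant (y : Z -> R) : Prop :=
  exists c : R, forall n : Z, (-1 <= n)%Z -> y n = c.

(* Main.v *)
(* Where y_n >= 0 the recurrence reads y_(n+1) - y_n = y_n - y_(n-1). Hence once
   y_n >= 0 and y_n > y_(n-1), the sequence is an increasing arithmetic
   progression. If y_n < 0, then y_(n+1) = - y_n - y_(n-1): either y_(n+1) >= 0 > y_n,
   or y_(n+1) < 0 and y_(n+2) = - y_(n+1) - y_n > 0 > y_(n+1), so that situation is
   reached after at most two steps. If no y_n with n >= 0 is negative, the whole
   sequence is an arithmetic progression, whose common difference cannot be
   negative, and is zero only for a constant sequence. *)
Require Import Defs.
From Stdlib Require Import Reals ZArith Lra Lia Classical.
From Coquelicot Require Import Coquelicot.
Open Scope R_scope.

(** The problem reindexed over [nat]: [u n] stands for y_(n-1), so [u 0] and [u 1] are the initial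
    data. *)
Definition abs_recurrence (u : nat -> R) : Prop :=
  forall n, u (S (S n)) = 3 / 2 * Rabs (u (S n)) + 1 / 2 * u (S n) - u n.

Lemma abs_recurrence_nonneg u n :
  abs_recurrence u -> 0 <= u (S n) -> u (S (S n)) = 2 * u (S n) - u n.
Proof. intros Hu Hn. rewrite Hu, Rabs_right; lra. Qed.

Lemma abs_recurrence_neg u n :
  abs_recurrence u -> u (S n) < 0 -> u (S (S n)) = - u (S n) - u n.
Proof. intros Hu Hn. rewrite Hu, Rabs_left; lra. Qed.

Lemma abs_recurrence_shift u k :
  abs_recurrence u -> abs_recurrence (fun n => u (n + k)%nat).
Proof. intros Hu n. exact (Hu (n + k)%nat). Qed.

Lemma is_lim_seq_arith_progression (a d : R) :
  0 < d -> is_lim_seq (fun n => a + INR n * d) p_infty.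
Proof.
  intros Hd.
  apply is_lim_seq_plus with (l1 := a) (l2 := p_infty).
  - apply is_lim_seq_const.
  - apply is_lim_seq_mult with (l1 := p_infty) (l2 := d).
    + exact is_lim_seq_INR.
    + apply is_lim_seq_const.
    + now apply is_Rbar_mult_p_infty_pos.
  - reflexivity.
Qed.

Lemma arith_progression_of_nonneg u :
  abs_recurrence u -> (forall n, 0 <= u (S n)) ->
  forall n, u n = u O + INR n * (u 1%nat - u O).
Proof.
  intros Hu Hpos n.
  (* The recurrence has order two, so the induction carries two consecutive terms. *)
  enough (H : u n = u O + INR n * (u 1%nat - u O) /\
              u (S n) = u O + INR (S n) * (u 1%nat - u O)) by apply H.
  induction n as [|n [IH IHS]].
  - simpl. lra.
  - split; [exact IHS|].
    rewrite (abs_recurrence_nonneg u n Hu (Hpos n)), IH, IHS, !S_INR. ring.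
Qed.

Lemma is_lim_seq_of_increase u :
  abs_recurrence u -> 0 <= u 1%nat -> u O < u 1%nat -> is_lim_seq u p_infty.
Proof.
  intros Hu H1 Hlt.
  (* Sign and growth propagate only jointly: the sign makes the next increment equal to the last
     one, and a positive increment preserves the sign. *)
  assert (Hinc : forall n, 0 <= u (S n) /\ u n < u (S n)).
  { induction n as [|n IH]; [now split|].
    pose proof (abs_recurrence_nonneg u n Hu (proj1 IH)). lra. }
  apply is_lim_seq_ext with (fun n => u O + INR n * (u 1%nat - u O)).
  - intros n. symmetry. apply arith_progression_of_nonneg; [exact Hu|].
    intros k. apply Hinc.
  - apply is_lim_seq_arith_progression. lra.
Qed.

Lemma is_lim_seq_of_increase_at u k :
  abs_recurrence u -> 0 <= u (S k) -> u k < u (S k) -> is_lim_seq u p_infty.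
Proof.
  intros Hu H1 Hlt. apply is_lim_seq_incr_n with k.
  now apply is_lim_seq_of_increase; [apply abs_recurrence_shift| |].
Qed.

Lemma is_lim_seq_of_neg u n :
  abs_recurrence u -> u (S n) < 0 -> is_lim_seq u p_infty.
Proof.
  intros Hu Hn.
  destruct (Rle_lt_dec 0 (u (S (S n)))) as [Hp|Hm].
  - apply is_lim_seq_of_increase_at with (S n); [exact Hu|exact Hp|lra].
  - pose proof (abs_recurrence_neg u (S n) Hu Hm).
    apply is_lim_seq_of_increase_at with (S (S n)); [exact Hu|lra|lra].
Qed.

Lemma abs_recurrence_dichotomy u :
  abs_recurrence u -> is_lim_seq u p_infty \/ forall n, u n = u O.
Proof.
  intros Hu.
  destruct (classic (exists n, u (S n) < 0)) as [[n Hn]|Hno].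
  { left. exact (is_lim_seq_of_neg u n Hu Hn). }
  assert (Hpos : forall n, 0 <= u (S n)).
  { intros n. apply Rnot_lt_le. intros Hn. apply Hno. now exists n. }
  pose proof (arith_progression_of_nonneg u Hu Hpos) as Hprog.
  destruct (Rtotal_order (u O) (u 1%nat)) as [Hlt|[Heq|Hgt]].
  - left. exact (is_lim_seq_of_increase u Hu (Hpos O) Hlt).
  - right. intros n. rewrite (Hprog n), <- Heq. ring.
  - exfalso.
    (* With d = [u 0 - u 1] > 0 and N d > [u 0], the term [u (S N)] = [u 0] - (N+1) d would be
       negative. *)
    destruct (INR_archimed (u O - u 1%nat) (u O)) as [N HN]; [lra|].
    pose proof (Hpos N) as HS. rewrite (Hprog (S N)), S_INR in HS. lra.
Qed.

Theorem theorem1 (y : Z -> R)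
  (hy : is_solution y) (hnc : ~ is_constant y) :
  is_lim_seq (fun n : nat => y (Z.of_nat n)) p_infty.
Proof.
  set (u := fun n : nat => y (Z.of_nat n - 1)%Z).
  assert (Hu : abs_recurrence u).
  { intros n. unfold u.
    replace (Z.of_nat (S (S n)) - 1)%Z with (Z.of_nat n + 1)%Z by lia.
    replace (Z.of_nat (S n) - 1)%Z with (Z.of_nat n) by lia.
    apply hy. lia. }
  destruct (abs_recurrence_dichotomy u Hu) as [Hlim|Hconst].
  - apply is_lim_seq_ext with (fun n => u (S n)).
    + intros n. unfold u. f_equal. lia.
    + now apply -> is_lim_seq_incr_1.
  - exfalso. apply hnc. exists (u O). intros n Hn.
    (* Since n >= -1, [Z.to_nat] truncates nothing here, and y_n is [u] at index n+1. *)
    rewrite <- (Hconst (Z.to_nat (n + 1))). unfold u. f_equal. lia.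
Qed.
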